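(* Let $A$ be a ring. Let $B$ be an $A$-algebra. Let $(I_\rho)_{\rho\in\mathbb{N}}$ and $(J_\rho)_{\rho\in\mathbb{N}}$ be two ideal semifiltrations of $A$ (so that $(I_\rho J_\rho)_{\rho\in\mathbb{N}}$ is also an ideal semifiltration of $A$). Let $n\in\mathbb{N}$. Let $u\in B$. Let $A_{[I]}$ denote the $A$-subalgebra $A[(I_\rho)_{\rho\in\mathbb{N}}\ast Y]$ of the polynomial ring $A[Y]$. (a) The sequence $\left(J_\tau A_{[I]}\right)_{\tau\in\mathbb{N}}$ is an ideal semifiltration of $A_{[I]}$. (b) The element $u$ of $B$ is $n$-integral over $\left(A,(I_\rho J_\rho)_{\rho\in\mathbb{N}}\right)$ if and only if the element $uY$ of the polynomial ring $B[Y]$ is $n$-integral over $\left(A_{[I]},(J_\tau A_{[I]})_{\tau\in\mathbb{N}}\right)$.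
   Context: All rings are commutative with unity, and ''$A$-algebra'' means commutative unital $A$-algebra (the structure map $A\to B$ need not be injective). $\mathbb{N}=\{0,1,2,\ldots\}$. An ideal semifiltration of a ring $A$ is a sequence $(I_\rho)_{\rho\in\mathbb{N}}$ of ideals of $A$ such that $I_0=A$ and $I_aI_b\subseteq I_{a+b}$ for all $a,b\in\mathbb{N}$. Given an ideal semifiltration $(I_\rho)_{\rho\in\mathbb{N}}$ of a ring $A$ and $n\in\mathbb{N}$, an element $u$ of an $A$-algebra $B$ is called $n$-integral over $(A,(I_\rho)_{\rho\in\mathbb{N}})$ if there exists $(a_0,a_1,\ldots,a_n)\in A^{n+1}$ such that $\sum_{k=0}^{n}a_ku^k=0$, $a_n=1$, and $a_i\in I_{n-i}$ for every $i\in\{0,1,\ldots,n\}$. The Rees algebra $A[(I_\rho)_{\rho\in\mathbb{N}}\ast Y]$ is the subset $\sum_{i\in\mathbb{N}}I_iY^i$ of $A[Y]$, i.e. the set of all polynomials $P\in A[Y]$ whose $i$-th coefficient lies in $I_i$ for every $i\in\mathbb{N}$; it is an $A$-subalgebra of $A[Y]$. The polynomial ring $B[Y]$ is an $A[Y]$-algebra via the ring homomorphism $A[Y]\to B[Y]$ induced by the structure map $A\to B$, and hence an algebra over the Rees algebra by restriction. For an ideal $J$ of $A$ and an $A$-algebra $A'$, $JA'$ denotes the ideal of $A'$ consisting of finite sums of products $ja'$ with $j\in J$, $a'\in A'$. *)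

(* Defs.v *)
From HB Require Import structures.
From mathcomp Require Import all_boot all_order all_algebra.
From mathcomp Require Import finmap.
From mathcomp Require Import boolp classical_sets.
From mathcomp Require Import monalg.

Set Implicit Arguments.
Unset Strict Implicit.
Unset Printing Implicit Defensive.

Import GRing.Theory.

Local Open Scope classical_set_scope.
Local Open Scope ring_scope.

(* Rings are [comPzRingType]s, so that the zero ring is allowed (it matters:   *)
(* [u] is 0-integral exactly when [1 = 0] in [B]). An [A]-algebra [B] is given *)
(* by its structure map [f : {rmorphism A -> B}], as MathComp's algebra types  *)
(* exclude the zero ring.                                                      *)

(* Elaborates the index in nat, also when it is an ordinal. *)
Local Notation "p @_ k" := (@mcoeff nat _ k p).

Section Polynomials.

(* MathComp's [{poly A}] also excludes the zero ring; here A[Y] is the monoid  *)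
(* algebra of (nat, +): finitely supported functions from nat to A, with       *)
(* [P@_i] the coefficient of Y^i and [<< a *g i >>] the monomial a Y^i.        *)
Definition pzpoly (A : comPzRingType) : Type := {malg A[nat]}.

HB.instance Definition _ (A : comPzRingType) := GRing.Zmodule.on (pzpoly A).

Definition monomY (A : comPzRingType) (a : A) (i : nat) : pzpoly A :=
  << a *g i >>.

Variable A : comPzRingType.
Implicit Types p q r : pzpoly A.

Definition pzmul p q : pzpoly A :=
  \sum_(i <- msupp p) \sum_(j <- msupp q) monomY (p@_i * q@_j) (i + j).

Let coefY (a : A) i k : (monomY a i)@_k = a *+ (i == k).
Proof. exact: mcoeffU. Qed.

Let coef_sum (I : Type) (s : seq I) (P : pred I) (F : I -> pzpoly A) k :
  (\sum_(i <- s | P i) F i)@_k = \sum_(i <- s | P i) (F i)@_k.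
Proof. exact: (raddf_sum (mcoeff k)). Qed.

Let sum_msupp p (F : nat -> A -> A) m : (forall i, F i 0 = 0) ->
    (forall i, (m <= i)%N -> F i p@_i = 0) ->
  \sum_(i <- msupp p) F i p@_i = \sum_(i < m) F i p@_i.
Proof.
move=> F0 Fm; rewrite -(big_mkord predT (fun i => F i p@_i)).
rewrite (bigID (fun i => i < m)%N) /= [X in _ + X]big1 ?addr0; last first.
  by move=> i; rewrite -leqNgt => /Fm.
rewrite -big_filter [RHS](bigID (fun i => i \in msupp p)) /=.
rewrite [X in _ = _ + X]big1 ?addr0; last first.
  by move=> i; rewrite -mcoeff_eq0 => /eqP->.
rewrite -[RHS]big_filter; apply/perm_big/uniq_perm.
- exact/filter_uniq/fset_uniq.
- exact/filter_uniq/iota_uniq.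
- by move=> i; rewrite !mem_filter mem_index_iota andbC.
Qed.

Lemma coef_pzmul p q k :
  (pzmul p q)@_k = \sum_(i < k.+1) p@_i * q@_(k - i)%N.
Proof.
rewrite coef_sum.
under eq_bigr => i _ do rewrite coef_sum.
under eq_bigr => i _ do under eq_bigr => j _ do rewrite coefY.
rewrite (@sum_msupp p (fun i a => \sum_(j <- msupp q)
  (a * q@_j) *+ (i + j == k)%N) k.+1); first 1 last.
- by move=> i; apply: big1 => j _; rewrite mul0r mul0rn.
- move=> i lt_ki; apply: big1 => j _.
  by rewrite gtn_eqF ?mulr0n // (leq_trans lt_ki) ?leq_addr.
apply: eq_bigr => i _; rewrite (@sum_msupp q (fun j b =>
  (p@_i * b) *+ (i + j == k)%N) k.+1); first 1 last.
- by move=> j; rewrite mulr0 mul0rn.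
- by move=> j lt_kj; rewrite gtn_eqF ?mulr0n // (leq_trans lt_kj) ?leq_addl.
have le_ik : (i <= k)%N by rewrite -ltnS.
rewrite (bigD1 (inord (k - i))) //= inordK ?ltnS ?leq_subr //.
rewrite subnKC // eqxx mulr1n big1 ?addr0 // => j.
rewrite -val_eqE /= inordK ?ltnS ?leq_subr // => ne.
case: eqP => // eq_k; case/negP: ne.
by rewrite -[X in X == _](addKn i) eq_k.
Qed.

Let pzmulC : commutative pzmul.
Proof.
move=> p q; apply/malgP => k; rewrite !coef_pzmul.
rewrite (reindex_inj rev_ord_inj) /=; apply: eq_bigr => i _.
by rewrite mulrC subSS subKn // -ltnS.
Qed.

Let pzmulDl : left_distributive pzmul +%R.
Proof.
move=> p q r; apply/malgP => k; rewrite mcoeffD !coef_pzmul -big_split /=.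
by apply: eq_bigr => i _; rewrite mcoeffD mulrDl.
Qed.

Let pzmulA : associative pzmul.
Proof.
move=> p q r; apply/malgP => k; rewrite !coef_pzmul.
pose coef3 i j := p@_i * (q@_(k - j - i)%N * r@_j).
transitivity (\sum_(i < k.+1) \sum_(j < k.+1 | (j <= k - i)%N) coef3 i j).
  apply: eq_bigr => /= i _; rewrite coef_pzmul big_distrr /=.
  rewrite (reindex_inj rev_ord_inj) big_ord_narrow_leq ?leq_subr // => le_ki.
  by apply: eq_bigr => j _; rewrite /coef3 /= subSS subKn -1?ltnS // subnAC.
rewrite (exchange_big_dep predT) //=; rewrite [RHS](reindex_inj rev_ord_inj) /=.
apply: eq_bigr => j _; rewrite subSS subKn -1?ltnS // coef_pzmul big_distrl /=.
rewrite (eq_bigl (fun i : 'I_k.+1 => i <= k - j)%N) => [|i]; last first.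
  by rewrite !leq_subRL -1?ltnS // addnC.
rewrite big_ord_narrow_leq ?leq_subr // => le_kj.
by apply: eq_bigr => i _; rewrite /coef3 mulrA.
Qed.

Let pzmul1 : left_id (monomY 1 0) pzmul.
Proof.
move=> p; apply/malgP => k; rewrite coef_pzmul big_ord_recl coefY mul1r subn0.
by rewrite big1 ?addr0 // => i _; rewrite coefY mul0r.
Qed.

HB.instance Definition _ := GRing.Zmodule_isComPzRing.Build (pzpoly A)
  pzmulA pzmulC pzmul1 pzmulDl.

End Polynomials.

Section PolynomialTheory.
Variable A : comPzRingType.
Implicit Types p q : pzpoly A.

Lemma pzpolyP p q : (forall k : nat, p@_k = q@_k) <-> p = q.
Proof. exact: malgP. Qed.

Lemma coef_monomY (a : A) i k : (monomY a i)@_k = a *+ (i == k).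
Proof. exact: mcoeffU. Qed.

Lemma coefY0 k : (0 : pzpoly A)@_k = 0.
Proof. exact: mcoeff0. Qed.

Lemma coefYN p k : (- p)@_k = - p@_k.
Proof. exact: mcoeffN. Qed.

Lemma coefYD p q k : (p + q)@_k = p@_k + q@_k.
Proof. exact: mcoeffD. Qed.

Lemma coefY1 k : (1 : pzpoly A)@_k = 1 *+ (0%N == k).
Proof. exact: coef_monomY. Qed.

Lemma coefYM p q k : (p * q)@_k = \sum_(i < k.+1) p@_i * q@_(k - i)%N.
Proof. exact: coef_pzmul. Qed.

End PolynomialTheory.

Section MapPolynomial.
Variables (A B : comPzRingType) (f : {rmorphism A -> B}).

(* The ring homomorphism A[Y] -> B[Y] induced by f. *)
Definition map_pzpoly (p : pzpoly A) : pzpoly B :=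
  \sum_(i <- msupp p) monomY (f p@_i) i.

Lemma coef_map_pzpoly p k : (map_pzpoly p)@_k = f p@_k.
Proof.
rewrite (raddf_sum (mcoeff k)) /=.
under eq_bigr => i _ do rewrite coef_monomY.
have [kp|kp] := boolP (k \in msupp p).
  rewrite (bigD1_seq k) ?fset_uniq //= eqxx mulr1n big1 ?addr0 // => i.
  by move/negPf->.
rewrite (mcoeff_outdom kp) rmorph0 big1_seq // => i /andP[_ ip].
by case: eqP ip kp => [-> ->|].
Qed.

Let map_pzpoly_zmod : zmod_morphism map_pzpoly.
Proof.
by move=> p q; apply/pzpolyP => k;
   rewrite coefYD coefYN !coef_map_pzpoly coefYD coefYN rmorphB.
Qed.

Let map_pzpoly_monoid : monoid_morphism map_pzpoly.
Proof.
split=> [|p q]; apply/pzpolyP => k; rewrite coef_map_pzpoly.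
  by rewrite !coefY1 rmorphMn rmorph1.
rewrite !coefYM rmorph_sum; apply: eq_bigr => i _.
by rewrite rmorphM !coef_map_pzpoly.
Qed.

HB.instance Definition _ :=
  GRing.isZmodMorphism.Build (pzpoly A) (pzpoly B) map_pzpoly map_pzpoly_zmod.
HB.instance Definition _ :=
  GRing.isMonoidMorphism.Build (pzpoly A) (pzpoly B) map_pzpoly
    map_pzpoly_monoid.

End MapPolynomial.

Section Ideals.
Variable A : comPzRingType.
Implicit Types S T : set A.

Record is_ideal S : Prop := IsIdeal {
  ideal0 : S 0;
  idealD : forall x y, S x -> S y -> S (x + y);
  ideal_mull : forall a x, S x -> S (a * x)
}.

(* Finite sums of products [s * t] with [s] in [S] and [t] in [T]; for ideals *)
(* [S] and [T] this is the product ideal.                                     *)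
Definition ideal_prod S T : set A :=
  [set x | exists2 s : seq (A * A),
     (forall p, p \in s -> S p.1 /\ T p.2) & x = \sum_(p <- s) p.1 * p.2].

Record is_semifiltration (I : nat -> set A) : Prop := IsSemifiltration {
  semifiltration_ideal : forall i, is_ideal (I i);
  semifiltration0 : I 0%N = setT;
  semifiltrationM : forall i j, ideal_prod (I i) (I j) `<=` I (i + j)%N
}.

Record semifiltration : Type := Semifiltration {
  semifiltration_val :> nat -> set A;
  semifiltrationP : is_semifiltration semifiltration_val
}.

End Ideals.

Section IdealTheory.
Variable A : comPzRingType.
Implicit Types S T : set A.

Lemma idealN S x : is_ideal S -> S x -> S (- x).
Proof. by move=> idS Sx; rewrite -mulN1r; apply: ideal_mull. Qed.

Lemma ideal_sum S (I : eqType) (s : seq I) (F : I -> A) : is_ideal S ->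
  (forall i, i \in s -> S (F i)) -> S (\sum_(i <- s) F i).
Proof.
move=> idS SF; rewrite big_seq; elim/big_ind: _ => //; first exact: ideal0.
exact: idealD.
Qed.

Lemma mem_ideal_prod S T s t : S s -> T t -> ideal_prod S T (s * t).
Proof.
move=> Ss Tt; exists [:: (s, t)]; last by rewrite big_seq1.
by move=> p; rewrite inE => /eqP->.
Qed.

Lemma ideal_prod_sub S T U : is_ideal U ->
  (forall s t, S s -> T t -> U (s * t)) -> ideal_prod S T `<=` U.
Proof.
by move=> idU STU x [l lP ->]; apply: ideal_sum => // p /lP[]; apply: STU.
Qed.

Lemma ideal_prod_ideal S T : is_ideal T -> is_ideal (ideal_prod S T).
Proof.
move=> idT; split=> [|x y [l lP ->] [m mP ->]|a x [l lP ->]].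
- by exists [::]; rewrite ?big_nil.
- exists (l ++ m); rewrite ?big_cat // => p.
  by rewrite mem_cat => /orP[/lP|/mP].
- exists [seq (p.1, a * p.2) | p <- l].
    by move=> _ /mapP[p /lP[Sp Tp] ->]; split=> //; apply: ideal_mull.
  by rewrite big_map big_distrr; apply: eq_bigr => p _ /=; rewrite mulrCA.
Qed.

Lemma ideal_prod_semifiltration (I J : semifiltration A) :
  is_semifiltration (fun i => ideal_prod (I i) (J i)).
Proof.
have [[idI I0 IM] [idJ J0 JM]] := (semifiltrationP I, semifiltrationP J).
split=> [i||i j]; first exact: ideal_prod_ideal.
  apply/seteqP; split=> // x _; rewrite -[x]mul1r.
  by apply: mem_ideal_prod; rewrite ?I0 ?J0.
have idIJ := ideal_prod_ideal (I (i + j)%N) (idJ (i + j)%N).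
apply: ideal_prod_sub => // s t [l lP ->] [m mP ->].
rewrite big_distrl; apply: ideal_sum => // p /lP[Ip Jp].
rewrite big_distrr; apply: ideal_sum => // q /mP[Iq Jq] /=.
by rewrite mulrACA; apply: mem_ideal_prod; [apply: IM|apply: JM]; apply: mem_ideal_prod.
Qed.

End IdealTheory.

Section Rees.
Variables (A : comPzRingType) (I : semifiltration A).

Definition rees_pred : {pred pzpoly A} :=
  fun p => `[< forall i : nat, I i p@_i >].

Record rees : predArgType := Rees {
  rees_val : pzpoly A;
  rees_valP : rees_val \in rees_pred
}.

HB.instance Definition _ := [isSub for rees_val].
HB.instance Definition _ := [Choice of rees by <:].

Lemma reesP p : reflect (forall i : nat, I i p@_i) (p \in rees_pred).
Proof. exact: asboolP. Qed.

Let idI := semifiltration_ideal (semifiltrationP I).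

Let rees_subring : subring_closed rees_pred.
Proof.
split=> [|p q /reesP Ip /reesP Iq|p q /reesP Ip /reesP Iq]; apply/reesP => k.
- rewrite coefY1; case: eqP => [<-|_]; last exact: ideal0.
  by rewrite (semifiltration0 (semifiltrationP I)).
- by rewrite coefYD coefYN; apply: idealD => //; apply: idealN.
rewrite coefYM; apply: ideal_sum => // i _.
have le_ik : (i <= k)%N by rewrite -ltnS.
rewrite -[X in I X](subnKC le_ik).
by apply: (semifiltrationM (semifiltrationP I)); apply: mem_ideal_prod.
Qed.

HB.instance Definition _ :=
  GRing.SubChoice_isSubComPzRing.Build (pzpoly A) rees_pred rees rees_subring.

Let reesC_subproof (a : A) : monomY a 0 \in rees_pred.
Proof.
apply/reesP => i; rewrite coef_monomY; case: eqP => [<-|_]; last exact: ideal0.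
by rewrite (semifiltration0 (semifiltrationP I)).
Qed.

(* The structure map of the Rees algebra as an A-algebra. *)
Definition reesC (a : A) : rees := Rees (reesC_subproof a).

Let reesC_zmod : zmod_morphism reesC.
Proof. by move=> a b; apply/val_inj/(raddfB (@mkmalgU nat A 0%N)). Qed.

Let reesC_monoid : monoid_morphism reesC.
Proof.
split=> [|a b]; apply/val_inj/pzpolyP => k //=.
rewrite coefYM big_ord_recl subn0 !coef_monomY mulr1n mulrnAr big1 ?addr0 //.
by move=> i _; rewrite coef_monomY mul0r.
Qed.

HB.instance Definition _ := GRing.isZmodMorphism.Build A rees reesC reesC_zmod.
HB.instance Definition _ :=
  GRing.isMonoidMorphism.Build A rees reesC reesC_monoid.

End Rees.

(* The ideal J A' of the A-algebra A' with structure map f. *)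
Definition ideal_ext (A A' : comPzRingType) (f : {rmorphism A -> A'})
    (J : set A) : set A' :=
  ideal_prod (f @` J) setT.

Definition n_integral (A B : comPzRingType) (f : {rmorphism A -> B})
    (I : nat -> set A) (n : nat) (u : B) : Prop :=
  exists a : 'I_n.+1 -> A,
    [/\ \sum_(k < n.+1) f (a k) * u ^+ k = 0,
        a ord_max = 1 &
        forall i : 'I_n.+1, I (n - i)%N (a i)].

(* The structure map of B[Y] as an algebra over the Rees algebra of I. *)
Definition rees_map (A B : comPzRingType) (I : semifiltration A)
    (f : {rmorphism A -> B}) : {rmorphism rees I -> pzpoly B} :=
  map_pzpoly f \o val.

(* Main.v *)
Require Import Defs.
From mathcomp Require Import all_boot all_order all_algebra.
From mathcomp Require Import boolp classical_sets.
From mathcomp Require Import monalg.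

Set Implicit Arguments.
Unset Strict Implicit.
Unset Printing Implicit Defensive.

(** Both directions of the equivalence come from the grading of [B[Y]] by the
    degree in [Y]. An equation [\sum_k f(a_k) u^k = 0] becomes, after
    multiplication by [Y^n], the equation
    [\sum_k f(a_k) Y^(n - k) (u Y)^k = 0]; conversely, the [Y^n]-coefficient of
    an equation [\sum_k P_k (u Y)^k = 0] is [\sum_k f(a_k) u^k = 0], where [a_k]
    is the coefficient of [Y^(n - k)] in [P_k].

    The membership conditions correspond because, inside the Rees algebra, the
    degree-[i] part of the extension of an ideal [K] is [I_i K]: coefficients of
    elements of the extension lie there ([coef_rees_ext]), and every element of
    [I_i K] is such a coefficient ([rees_ext_monomY]). With [K = J_(n - k)] and
    [i = n - k] this is the ideal [I_(n - k) J_(n - k)].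

    That the extensions of the [J_t] to the Rees algebra form a semifiltration
    holds for extension along any ring homomorphism ([ideal_ext_semifiltration]). *)

Import GRing.Theory.

Local Open Scope classical_set_scope.
Local Open Scope ring_scope.

(* The index is elaborated in nat, also when it is an ordinal. *)
Local Notation "p @_ k" := (@mcoeff nat _ k p).

Section Monomials.
Variable A : comPzRingType.
Implicit Types (p : pzpoly A) (a b : A).

Lemma coefY_sum (T : Type) (s : seq T) (F : T -> pzpoly A) k :
  (\sum_(i <- s) F i)@_k = \sum_(i <- s) (F i)@_k.
Proof. exact: (raddf_sum (mcoeff k)). Qed.

Lemma coefYM_monomY p b j k :
  (p * monomY b j)@_k = (p@_(k - j)%N * b) *+ (j <= k)%N.
Proof.
rewrite coefYM; have [le_jk|lt_kj] := leqP j k; last first.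
  rewrite big1 // => i _; rewrite coef_monomY gtn_eqF ?mulr0 //.
  by rewrite (leq_ltn_trans _ lt_kj) ?leq_subr.
have lt_kjk : (k - j < k.+1)%N by rewrite ltnS leq_subr.
rewrite (bigD1 (Ordinal lt_kjk)) //= big1 => [|i].
  by rewrite addr0 coef_monomY subKn // eqxx.
rewrite -val_eqE /= coef_monomY => ne_i.
case: eqP => [jE|_]; last by rewrite mulr0.
by move: ne_i; rewrite jE subKn ?eqxx // -ltnS.
Qed.

Lemma monomYM a b i j : monomY a i * monomY b j = monomY (a * b) (i + j).
Proof.
apply/pzpolyP => k; rewrite coefYM_monomY !coef_monomY.
have [le_jk|lt_kj] := leqP j k.
  by rewrite -(eqn_add2r j) subnK // mulrnAl.
by rewrite (@gtn_eqF k (i + j)) // (leq_trans lt_kj) ?leq_addl.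
Qed.

Lemma monomY1X b k : monomY b 1 ^+ k = monomY (b ^+ k) k.
Proof. by elim: k => [//|k IHk]; rewrite !exprS IHk monomYM. Qed.

Lemma monomY_sum (T : Type) (s : seq T) (F : T -> A) i :
  monomY (\sum_(x <- s) F x) i = \sum_(x <- s) monomY (F x) i.
Proof.
apply/pzpolyP => k; rewrite coefY_sum coef_monomY -sumrMnl.
by apply: eq_bigr => x _; rewrite coef_monomY.
Qed.

End Monomials.

Lemma map_monomY (A B : comPzRingType) (f : {rmorphism A -> B}) (a : A) i :
  map_pzpoly f (monomY a i) = monomY (f a) i.
Proof.
by apply/pzpolyP => k; rewrite coef_map_pzpoly !coef_monomY rmorphMn.
Qed.

(** On generators, [(g a * x) * (g b * y) = g (a * b) * (x * y)], where [a * b]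
    lies in [J_(i + j)] as soon as [a] lies in [J_i] and [b] in [J_j]. *)
Lemma ideal_ext_semifiltration (A A' : comPzRingType) (g : {rmorphism A -> A'})
    (J : semifiltration A) : is_semifiltration (fun t => ideal_ext g (J t)).
Proof.
have [idJ J0 JM] := semifiltrationP J.
have idT : is_ideal [set: A'] by split.
have idE t : is_ideal (ideal_ext g (J t)) by apply: ideal_prod_ideal.
split=> // [|i j].
  apply/seteqP; split=> // x _; rewrite -[x]mul1r -(rmorph1 g).
  by apply: mem_ideal_prod => //; exists 1; rewrite ?J0.
apply: ideal_prod_sub => // s t [l lP ->] [m mP ->].
rewrite big_distrl; apply: ideal_sum => // p /lP[[a Ja pE] _].
rewrite big_distrr; apply: ideal_sum => // q /mP[[b Jb qE] _] /=.
rewrite mulrACA -pE -qE -rmorphM; apply: mem_ideal_prod => //.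
by exists (a * b) => //; apply: JM; apply: mem_ideal_prod.
Qed.

Section ReesIdeals.
Variables (A : comPzRingType) (I : semifiltration A).
Variables (K : set A) (idK : is_ideal K).

(* [rmorphD] and [rmorphM] specialized to the projection itself: the generic
   [val] reaches the goals through different inheritance paths, on which these
   lemmas do not rewrite. *)
Let rees_valD : {morph @rees_val A I : P Q / P + Q}.
Proof. exact: (rmorphD (val : rees I -> pzpoly A)). Qed.

Let rees_valM : {morph @rees_val A I : P Q / P * Q}.
Proof. exact: (rmorphM (val : rees I -> pzpoly A)). Qed.

(** On the generators of the extended ideal this is the fact that multiplying by
    a constant of [K] acts coefficientwise, the [i]-th coefficient being in
    [I_i]. *)
Lemma coef_rees_ext (P : rees I) i :
  ideal_ext (@reesC A I) K P -> ideal_prod (I i) K (rees_val P)@_i.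
Proof.
move=> [l lP ->]; rewrite (big_morph _ rees_valD (erefl (rees_val 0))) coefY_sum.
apply: ideal_sum => [|p /lP[[b Kb <-] _]]; first exact: ideal_prod_ideal.
rewrite mulrC rees_valM /= coefYM_monomY subn0; apply: mem_ideal_prod => //.
exact/reesP/rees_valP.
Qed.

(** For [s] in [I_i] and [t] in [K], the monomial [s t Y^i] is the product of the
    constant [t] and the element [s Y^i] of the Rees algebra. *)
Lemma rees_ext_monomY (a : A) i : ideal_prod (I i) K a ->
  exists2 P : rees I, ideal_ext (@reesC A I) K P & rees_val P = monomY a i.
Proof.
have idE : is_ideal (ideal_ext (@reesC A I) K) by apply: ideal_prod_ideal.
move=> [l lP ->]; rewrite monomY_sum.
elim: l lP => [|[s t] l IHl] lP.
  by exists 0; [apply: ideal0|rewrite big_nil].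
have [P EP PE] := IHl (fun p lp => lP p (mem_behead (s := _ :: _) lp)).
have [/= Is Kt] := lP (s, t) (mem_head _ _).
have sYP : monomY s i \in rees_pred I.
  apply/reesP => k; rewrite coef_monomY; case: eqP => [<- //|_].
  exact: ideal0 (semifiltration_ideal (semifiltrationP I) k).
exists (reesC I t * Rees sYP + P).
  by apply: idealD => //; apply: mem_ideal_prod => //; exists t.
by rewrite big_cons rees_valD rees_valM /= PE monomYM mulrC add0n.
Qed.

End ReesIdeals.

Theorem theorem3p2 (A B : comPzRingType) (f : {rmorphism A -> B})
    (I J : semifiltration A) (n : nat) (u : B) :
  let JA : nat -> set (rees I) := fun t => ideal_ext (@reesC A I) (J t) in
  is_semifiltration JA
  /\ (n_integral f (fun r => ideal_prod (I r) (J r)) n u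
      <-> n_integral (rees_map I f) JA n (monomY u 1)).
Proof.
move=> JA; split; first exact: ideal_ext_semifiltration.
have idJ := semifiltration_ideal (semifiltrationP J).
have le_n (k : 'I_n.+1) : (k <= n)%N by rewrite -ltnS.
split=> [[a [sum_a a_max IJa]]|[P [sum_P P_max JP]]].
  have /choice[P PP] : forall k : 'I_n.+1, exists P : rees I,
      JA (n - k)%N P /\ rees_val P = monomY (a k) (n - k).
    by move=> k; have [P JP PE] := rees_ext_monomY (IJa k); exists P.
  exists P; split=> [||k]; last by have [] := PP k.
    transitivity (monomY (\sum_(k < n.+1) f (a k) * u ^+ k) n); last first.
      by rewrite sum_a; apply/pzpolyP => k; rewrite coef_monomY coefY0 mul0rn.
    rewrite monomY_sum; apply: eq_bigr => k _.
    by rewrite /= (PP k).2 map_monomY monomY1X monomYM subnK.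
  by apply: val_inj; rewrite /= (PP ord_max).2 a_max subnn.
exists (fun k : 'I_n.+1 => (rees_val (P k))@_(n - k)%N); split=> [||k].
- rewrite -[RHS](coefY0 B n) -sum_P coefY_sum; apply: eq_bigr => k _.
  by rewrite monomY1X coefYM_monomY le_n coef_map_pzpoly.
- by rewrite P_max subnn coefY1.
- exact: coef_rees_ext (JP k).
Qed.
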